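(* Let $G=\mathrm{PGL}_2(q)$ with $q$ odd. Then any maximal subgroup of $G$ of type $\mathrm{D}_{2(q-1)}$ has non-trivial intersection with any maximal subgroup of $G$ of type $\mathrm{D}_{2(q+1)}$.
   Context: $q$ is a power of an odd prime. $\mathrm{D}_{2n}$ denotes the dihedral group of order $2n$, with $n\ge 3$. A maximal subgroup ''of type $\mathrm{D}_{2m}$'' is a maximal subgroup isomorphic to $\mathrm{D}_{2m}$. *)

(* Defs.v *)
From mathcomp Require Import all_boot all_order all_fingroup all_algebra all_solvable.

Set Implicit Arguments.
Unset Strict Implicit.
Unset Printing Implicit Defensive.

Local Open Scope group_scope.

(* 'Z('GL_2[F]) is the subgroup of scalar matrices. *)
Definition PGL2 (F : finFieldType) : {group coset_of 'Z('GL_2[F])} :=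
  ('GL_2[F] / 'Z('GL_2[F]))%G.

(* 'D_k is indexed by its order k, so 'D_(2 * m) is dihedral of order 2m. *)
Definition maximal_of_dihedral_type (gT : finGroupType) (G : {group gT})
    (m : nat) (M : {group gT}) : Prop :=
  maximal M G /\ M \isog 'D_(2 * m).

(* Main.v *)
Require Import Defs.
From mathcomp Require Import all_boot all_order all_fingroup all_algebra all_solvable.

Set Implicit Arguments.
Unset Strict Implicit.
Unset Printing Implicit Defensive.

(** Both dihedral groups have order divisible by four, so M and N contain
    central involutions z and t.  Since PGL2(F) has trivial center,
    maximality forces M = 'C[z] and N = 'C[t] (maximal_cent1, center_PGL2),
    and the task is to find a nontrivial element commuting with z and t.

    Lift z and t to matrices A and B, with A^2 and B^2 scalar, and consider
    the commutator Y = AB - BA, which anticommutes with both A and B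
    (commutator_anticommute).
    - If Y = 0, then z and t commute, and z itself lies in M and N.
    - If Y is invertible, its class commutes with z and t, because -1 is
      trivial in PGL2(F); it is not the identity, because a scalar matrix
      cannot anticommute with A when 2 != 0.
    - If Y is singular but nonzero, its row space is a line invariant under
      both A and B.  Then z and t are both split involutions, hence conjugate
      (scaled_conj_of_singular_commutator), so M and N have the same order.
      This contradicts |M| = 2(q - 1) and |N| = 2(q + 1). *)

Local Open Scope group_scope.

(** * Central involutions and maximal subgroups *)

(** The involution is x ^+ (m / 2) for a rotation x of order m: the reflection
    y inverts it, and an involution is its own inverse.  For m = 2 the group
    is a Klein four-group and the argument is unchanged. *)
Lemma dihedral_central_involution (gT : finGroupType) (G : {group gT}) m :
    1 < m -> ~~ odd m -> G \isog 'D_(2 * m) ->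
  exists z, [/\ z \in 'Z(G), z != 1 & z ^+ 2 = 1].
Proof.
move=> m_gt1 m_even; rewrite mul2n.
case/(isoGrpP _ (Grp_dihedral m_gt1)); rewrite card_dihedral // => oG.
case/existsP=> -[x y] /= /eqP[defG xm y2 xy].
have Gx : x \in G by rewrite -defG mem_gen // inE cycle_id.
(* The presentation only bounds the order of x from above; counting the
   product <[x]> * <[y]> gives the lower bound. *)
have {}oG : #|<[x]> * <[y]>| = m.*2.
  by rewrite -norm_joinEr ?defG // norms_cycle xy groupV cycle_id.
have ox : m <= #[x].
  have oy : #[y] <= 2 by rewrite dvdn_leq // order_dvdn y2.
  rewrite -leq_double -oG -[_.*2]muln2.
  rewrite (leq_trans _ (leq_mul (leqnn _) oy)) //.
  by rewrite mul_cardG leq_pmulr ?cardG_gt0.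
have m2 : m = (m./2 * 2)%N by rewrite muln2 even_halfK.
have h_gt0 : 0 < m./2 by rewrite half_gt0.
have z2 : (x ^+ m./2) ^+ 2 = 1 by rewrite -expgM -m2.
exists (x ^+ m./2); split=> //; last first.
  rewrite -order_dvdn gtnNdvd //; apply: leq_trans ox.
  by rewrite [X in _ < X]m2 muln2 -addnn -[X in X < _]addn0 ltn_add2l.
rewrite inE groupX //= -sub_cent1 -defG join_subG !cycle_subG.
apply/andP; split; first by rewrite cent1C groupX ?cent1id.
rewrite cent1C; apply/cent1P/commgP/conjg_fixP; rewrite conjXg xy expgVn.
by apply/eqP; rewrite eq_invg_mul -(expgS _ 1) z2.
Qed.

Lemma maximal_cent1 (gT : finGroupType) (G M : {group gT}) z :
  maximal M G -> z \in 'Z(M) -> z \notin 'Z(G) -> M :=: 'C_G[z].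
Proof.
case/maxgroupP=> /andP[sMG _] maxM /setIP[Mz cMz] nZz.
apply/esym/maxM; last by rewrite subsetI sMG sub_cent1.
rewrite properEneq subsetIl andbT; apply: contra nZz => /eqP defC.
by rewrite inE (subsetP sMG) //= -sub_cent1 -{1}defC subsetIr.
Qed.

(** * Projective commutation of 2 x 2 matrices *)

Section Matrices.
Local Open Scope ring_scope.
Import GRing.Theory.

Lemma scalar_of_commute_delta (R : pzRingType) n (A : 'M[R]_n) :
    (forall i j, i != j -> A *m delta_mx i j = delta_mx i j *m A) ->
  is_scalar_mx A.
Proof.
case: n A => [|n] A cA.
  by apply/is_scalar_mxP; exists 0; apply/matrixP=> -[].
have E1 i j k l : (A *m delta_mx i j) k l = A k i *+ (l == j).
  rewrite !mxE (bigD1 i) //= !mxE eqxx big1 ?addr0.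
    by rewrite mulr_natr.
  by move=> p /negPf np; rewrite !mxE np mulr0.
have E2 i j k l : (delta_mx i j *m A) k l = A j l *+ (k == i).
  rewrite !mxE (bigD1 j) //= !mxE eqxx andbT big1 ?addr0.
    by rewrite mulr_natl.
  by move=> p /negPf np; rewrite !mxE np andbF mul0r.
have cE i j k l : i != j -> A k i *+ (l == j) = A j l *+ (k == i).
  by move=> /cA cij; rewrite -E1 -E2 cij.
apply/is_scalar_mxP; exists (A 0 0); apply/matrixP=> i j; rewrite !mxE.
have [<-|nij] := eqVneq i j; last first.
  have := cE j i i i; rewrite eq_sym => /(_ nij).
  by rewrite eqxx (negPf nij).
have [-> //|ni0] := eqVneq i 0.
by have := cE _ _ i 0 ni0; rewrite !eqxx.
Qed.

(** Take U a transvection.  The matrices A U A^-1 and c U must have the same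
    trace, and U has trace 2, so c = 1 and A genuinely commutes with U. *)
Lemma scalar_of_proj_central (F : fieldType) (A : 'M[F]_2) :
    (2 : F) != 0 -> A \in unitmx ->
    (forall U, U \in unitmx -> exists c, A *m U = c *: (U *m A)) ->
  is_scalar_mx A.
Proof.
move=> nz2 uA cA; apply: scalar_of_commute_delta => i j nij.
pose U : 'M[F]_2 := 1%:M + delta_mx i j.
have dd : delta_mx i j *m delta_mx i j = 0 :> 'M[F]_2.
  by rewrite mul_delta_mx_0 // eq_sym.
have uU : U \in unitmx.
  have /mulmx1_unit[//] : U *m (1%:M - delta_mx i j) = 1%:M.
  by rewrite mulmxDl mulmxBr mulmxBr !mul1mx mulmx1 dd subr0 subrK.
have [c AU] := cA U uU.
have trU : \tr U = 2.
  rewrite raddfD /= mxtrace1 -[X in _ + X]/(\tr (delta_mx i j)).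
  rewrite /mxtrace big1 ?addr0 // => k _; rewrite mxE.
  by case: eqP => //= ->; rewrite (negPf nij).
have c1 : c = 1.
  apply: (mulIf nz2); rewrite -trU mul1r -mxtraceZ.
  have <- : A *m U *m invmx A = c *: U by rewrite AU -scalemxAl mulmxK.
  by rewrite mxtrace_mulC mulmxA mulVmx // mul1mx.
by move: AU; rewrite c1 scale1r mulmxDl mulmxDr mulmx1 mul1mx => /addrI.
Qed.

Lemma commutator_anticommute (R : comPzRingType) n (A B : 'M[R]_n) a :
    A *m A = a%:M ->
  (A *m B - B *m A) *m A = - A *m (A *m B - B *m A).
Proof.
move=> AA; rewrite mulNmx mulmxBl mulmxBr opprB -(mulmxA B) AA scalar_mxC.
by rewrite !mulmxA AA.
Qed.

(** The commutator Y has rank one, and its row space, spanned by v say, is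
    stable under A and B since they anticommute with Y.  Hence v is a common
    eigenvector, for eigenvalues k and l with k^2 = a and l^2 = b.  The
    rescaled matrices A1 = A / k and B1 = B / l square to 1 and fix v, and
    C = A1 + B1 satisfies A1 C = 1 + A1 B1 = C B1, so C conjugates A1 to B1 as
    soon as it is invertible.  If x C = 0 then x A1 = - x B1, from which
    x Y = 0; the left kernel of Y is spanned by v, and v C = 2 v, so x = 0. *)
Lemma scaled_conj_of_singular_commutator (F : fieldType) (A B : 'M[F]_2) a b :
    (2 : F) != 0 -> a != 0 -> b != 0 -> A *m A = a%:M -> B *m B = b%:M ->
    A *m B - B *m A != 0 -> A *m B - B *m A \notin unitmx ->
  exists c U, U \in unitmx /\ A *m U = c *: (U *m B).
Proof.
move=> nz2 nza nzb AA BB; set Y := _ - _ => nzY singY.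
have rY : \rank Y = 1%N.
  apply/eqP; rewrite eqn_leq lt0n mxrank_eq0 nzY andbT -ltnS.
  rewrite ltn_neqAle rank_leq_row andbT.
  by apply: contra singY; rewrite -row_free_unit.
pose v := nz_row Y.
have nzv : v != 0 by rewrite nz_row_eq0.
have vY : (v <= Y)%MS by apply: nz_row_sub.
have Yv : (Y <= v)%MS.
  by rewrite -(geq_leqif (mxrank_leqif_sup vY)) rY rank_rV nzv.
have YA : Y *m A = - A *m Y := commutator_anticommute B AA.
have YB : Y *m B = - B *m Y.
  by rewrite /Y -opprB mulNmx (commutator_anticommute A BB) mulmxN.
have eigen C c : C *m C = c%:M -> Y *m C = - C *m Y -> c != 0 ->
    exists2 k, k * k = c & v *m C = k *: v.
  move=> CC YC nzc.
  have /sub_rVP[k vC] : (v *m C <= v)%MS.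
    rewrite (submx_trans (submxMr _ vY)) // YC.
    exact: submx_trans (submxMl _ _) Yv.
  exists k => //; apply/eqP; rewrite -subr_eq0.
  move: nzv; apply: contraNT => nz.
  rewrite -[v == 0]orFb -(negPf nz) -scaler_eq0 scalerBl -scalerA -vC.
  by rewrite scalemxAl -vC -mulmxA CC mul_mx_scalar subrr.
have [k kk vA] := eigen A a AA YA nza.
have [l ll vB] := eigen B b BB YB nzb.
have nzk : k != 0 by apply: contra nza => /eqP k0; rewrite -kk k0 mul0r.
have nzl : l != 0 by apply: contra nzb => /eqP l0; rewrite -ll l0 mul0r.
pose A1 := k^-1 *: A; pose B1 := l^-1 *: B.
have A11 : A1 *m A1 = 1%:M.
  rewrite -scalemxAl -scalemxAr scalerA AA -kk scale_scalar_mx.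
  by rewrite mulrACA mulVf ?mulr1.
have B11 : B1 *m B1 = 1%:M.
  rewrite -scalemxAl -scalemxAr scalerA BB -ll scale_scalar_mx.
  by rewrite mulrACA mulVf ?mulr1.
have vA1 : v *m A1 = v by rewrite -scalemxAr vA scalerA mulVf ?scale1r.
have vB1 : v *m B1 = v by rewrite -scalemxAr vB scalerA mulVf ?scale1r.
have Y1 : A1 *m B1 - B1 *m A1 = (k^-1 * l^-1) *: Y.
  by rewrite -!scalemxAl -!scalemxAr !scalerA (mulrC l^-1) -scalerBr.
have vkerY : (v <= kermx Y)%MS.
  apply/sub_kermxP; apply: (scalerI (a := k^-1 * l^-1)).
    by rewrite mulf_neq0 ?invr_neq0.
  by rewrite scaler0 scalemxAr -Y1 mulmxBr !mulmxA vA1 vB1 vA1 subrr.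
have kerYv : (kermx Y <= v)%MS.
  by rewrite -(geq_leqif (mxrank_leqif_sup vkerY)) rank_rV nzv mxrank_ker rY.
exists (k * l^-1), (A1 + B1); split.
  rewrite -row_free_unit; apply/inj_row_free => x.
  rewrite mulmxDr => /eqP; rewrite addr_eq0 => /eqP xAB.
  have xY : (x <= kermx Y)%MS.
    apply/sub_kermxP; apply: (scalerI (a := k^-1 * l^-1)).
      by rewrite mulf_neq0 ?invr_neq0.
    rewrite scaler0 scalemxAr -Y1 mulmxBr !mulmxA xAB mulNmx.
    rewrite -(mulmxA x B1 B1) B11 -[x *m B1]opprK -xAB mulNmx.
    by rewrite -(mulmxA x A1 A1) A11 opprK addrC subrr.
  have /sub_rVP[c def_x] := submx_trans xY kerYv.
  have /eqP := xAB; rewrite def_x -!scalemxAl vA1 vB1 -addr_eq0 -mulr2n.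
  by rewrite -scaler_nat scaler_eq0 (negPf nz2) => /eqP.
have defA : A = k *: A1 by rewrite scalerA mulfV ?scale1r.
have defB : B = l *: B1 by rewrite scalerA mulfV ?scale1r.
rewrite {1}defA defB -scalemxAl -scalemxAr scalerA mulfVK //.
by rewrite mulmxDr mulmxDl A11 B11 addrC.
Qed.

End Matrices.

(** * The group PGL2 *)

Section ProjectiveGroup.

Variable F : finFieldType.
Local Notation Z := 'Z('GL_2[F]).
Implicit Types g h : {'GL_2[F]}.

Lemma GL2_lift (U : 'M[F]_2) : U \in unitmx -> exists g, GLval g = U.
Proof. by move=> uU; exists (Sub U uU); rewrite -[GLval _]/(val _) SubK. Qed.

Lemma GL2_norm_center g : g \in 'N(Z).
Proof. by rewrite (subsetP (normal_norm (center_normal _))) ?inE. Qed.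

Lemma GL2_centerE g : (2 : F)%R != 0%R -> (g \in Z) = is_scalar_mx (GLval g).
Proof.
move=> nz2; apply/idP/is_scalar_mxP=> [/setIP[_ /centP cg] | [a def_g]].
  apply/is_scalar_mxP/(scalar_of_proj_central nz2); first exact: (GL_unitmx g).
  move=> _ /GL2_lift[h <-]; exists 1%R.
  rewrite GRing.scale1r -[LHS]/(GLval (g * h)) -[RHS]/(GLval (h * g)).
  by rewrite cg ?inE.
rewrite !inE; apply/centP=> h _; apply/val_inj.
by rewrite -[LHS]/(GLval g *m GLval h)%R def_g -scalar_mxC -def_g.
Qed.

Lemma PGL2_eqP g h : (2 : F)%R != 0%R ->
  reflect (exists c, GLval g = (c *: GLval h)%R) (coset Z g == coset Z h).
Proof.
move=> nz2; apply: (iffP eqP) => [/rcoset_kercosetP|[c def_g]].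
  rewrite !GL2_norm_center => /(_ isT isT)/rcosetP[k Zk ->].
  move: Zk; rewrite (GL2_centerE _ nz2) => /is_scalar_mxP[c def_k].
  by exists c; rewrite GL_MxE def_k mul_scalar_mx.
apply/rcoset_kercosetP; rewrite ?GL2_norm_center //.
rewrite mem_rcoset (GL2_centerE _ nz2).
apply/is_scalar_mxP; exists c.
by rewrite GL_MxE GL_VxE def_g -scalemxAl mulmxV ?scalemx1 ?GL_unitmx.
Qed.

Lemma PGL2_commuteP g h : (2 : F)%R != 0%R ->
  reflect (exists c, GLval g *m GLval h = c *: (GLval h *m GLval g))%R
          (coset Z g \in 'C[coset Z h]).
Proof.
move=> nz2.
have -> : (coset Z g \in 'C[coset Z h]) = (coset Z (g * h) == coset Z (h * g)).
  by rewrite !morphM ?GL2_norm_center //; apply/cent1P/eqP.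
by apply: (iffP (PGL2_eqP _ _ nz2)) => -[c e]; exists c.
Qed.

Lemma mem_PGL2 z : z \in PGL2 F.
Proof.
by have [g Ng ->] := cosetP z; rewrite mem_quotient ?inE.
Qed.

Lemma center_PGL2 : (2 : F)%R != 0%R -> 'Z(PGL2 F) = 1.
Proof.
move=> nz2; apply/trivgP/subsetP=> z /setIP[_ /centP cz].
have [g Ng def_z] := cosetP z; subst z.
rewrite inE; apply/eqP/coset_id; rewrite (GL2_centerE _ nz2).
apply: (scalar_of_proj_central nz2); first exact: (GL_unitmx g).
move=> _ /GL2_lift[h <-]; apply/(PGL2_commuteP _ _ nz2)/cent1P/cz/mem_PGL2.
Qed.

Lemma PGL2_involution_lift g : (2 : F)%R != 0%R ->
  coset Z g ^+ 2 = 1 -> exists2 a, a != 0%R & (GLval g *m GLval g = a%:M)%R.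
Proof.
move=> nz2; rewrite (expgS _ 1) expg1 -morphM ?GL2_norm_center //.
rewrite -(morph1 (coset Z)).
case/eqP/(PGL2_eqP _ _ nz2)=> a; rewrite GL_MxE GL_1E scalemx1 => gg.
exists a => //.
apply/eqP=> a0; have := GL_unit (g * g).
by rewrite GL_MxE gg a0 GRing.raddf0 GRing.unitr0.
Qed.

End ProjectiveGroup.

(** In characteristic two the additive group has an element of order two, so
    its order is even. *)
Lemma odd_card_two_neq0 (F : finFieldType) : odd #|F| -> (2 : F)%R != 0%R.
Proof.
apply: contraL => /eqP two0.
have : #[1%R : F] %| #|[set: F]| by rewrite order_dvdG ?inE.
suff -> : #[1%R : F] = 2 by rewrite cardsT dvdn2.
apply: nt_prime_order => //; exact: GRing.oner_neq0.
Qed.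

Theorem proposition2p7 (q : nat) (F : finFieldType)
    (hF : #|F| = q) (hq : odd q)
    (M N : {group coset_of 'Z('GL_2[F])})
    (hM : maximal_of_dihedral_type (PGL2 F) (q - 1) M)
    (hN : maximal_of_dihedral_type (PGL2 F) (q + 1) N) :
  M :&: N != 1.
Proof.
have nz2 : (2 : F)%R != 0%R by rewrite odd_card_two_neq0 ?hF.
have q_gt2 : 2 < q.
  have: 1 < q by rewrite -hF card_finRing_gt1.
  by rewrite leq_eqVlt; case: eqP hq => // <-.
have m1_gt1 : 1 < q - 1 by rewrite ltn_subRL.
have m2_gt1 : 1 < q + 1 by rewrite addn1 ltnS (ltn_trans _ q_gt2).
case: hM hN => maxM isoM [maxN isoN].
have [|z [ZMz nz_z z2]] := dihedral_central_involution m1_gt1 _ isoM.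
  by rewrite oddB ?hq // (ltn_trans _ q_gt2).
have [|t [ZNt nz_t t2]] := dihedral_central_involution m2_gt1 _ isoN.
  by rewrite oddD hq.
have defM : M :=: 'C_(PGL2 F)[z].
  by apply: maximal_cent1 => //; rewrite center_PGL2 // inE.
have defN : N :=: 'C_(PGL2 F)[t].
  by apply: maximal_cent1 => //; rewrite center_PGL2 // inE.
have inM x : (x \in M) = (x \in 'C[z]) by rewrite defM inE mem_PGL2.
have inN x : (x \in N) = (x \in 'C[t]) by rewrite defN inE mem_PGL2.
have nontriv x : x != 1 -> x \in 'C[z] -> x \in 'C[t] -> M :&: N != 1.
  move=> nx xz xt; apply: contra nx => /eqP MN1.
  by rewrite -in_set1 -[[set _]]MN1 inE inM inN xz.
have [g Ng def_z] := cosetP z; have [h Nh def_t] := cosetP t; subst z t.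
have [a nza AA] := PGL2_involution_lift nz2 z2.
have [b nzb BB] := PGL2_involution_lift nz2 t2.
set A := GLval g in AA; set B := GLval h in BB.
pose Y := (A *m B - B *m A)%R.
have YA : (Y *m A = - A *m Y)%R := commutator_anticommute B AA.
have YB : (Y *m B = - B *m Y)%R.
  by rewrite /Y -GRing.opprB mulNmx (commutator_anticommute A BB) mulmxN.
have [Y0 | nzY] := eqVneq Y 0%R.
  apply: (nontriv (coset _ g)); rewrite ?cent1id //.
  apply/PGL2_commuteP => //; exists 1%R.
  by rewrite GRing.scale1r; apply/eqP; rewrite -GRing.subr_eq0 -/A -/B -/Y Y0.
have [uY | singY] := boolP (Y \in unitmx).
  have [y def_y] := GL2_lift uY.
  apply: (nontriv (coset _ y)).
  - apply: contra (nz2) => /eqP y1.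
    have /is_scalar_mxP[c Yc] : is_scalar_mx Y.
      rewrite -def_y -(GL2_centerE _ nz2); apply: coset_idr => //.
      exact: GL2_norm_center.
    have : (2 *: (A *m Y) = 0)%R.
      rewrite GRing.scaler_nat GRing.mulr2n -[X in (X + _)%R]GRing.opprK.
      by rewrite -mulNmx -YA Yc scalar_mxC GRing.addNr.
    move/eqP; rewrite GRing.scaler_eq0 => /orP[// | /eqP AY0].
    have := GL_unit (g * y).
    by rewrite GL_MxE def_y AY0 GRing.unitr0.
  - apply/PGL2_commuteP => //; exists (-1)%R.
    by rewrite def_y YA mulNmx GRing.scaleN1r.
  apply/PGL2_commuteP => //; exists (-1)%R.
  by rewrite def_y YB mulNmx GRing.scaleN1r.
(* A singular commutator makes z and t conjugate in PGL2, against the orders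
   of their centralizers M and N. *)
have [c [U [uU AU]]] :=
  scaled_conj_of_singular_commutator nz2 nza nzb AA BB nzY singY.
have [u def_u] := GL2_lift uU.
have zt : coset 'Z('GL_2[F]) g ^ coset 'Z('GL_2[F]) u = coset _ h.
  rewrite conjgE; apply: (canLR (mulKg _)).
  rewrite -!morphM ?GL2_norm_center //; apply/eqP/PGL2_eqP => //.
  by exists c; rewrite !GL_MxE def_u.
have : #|M| = #|N|.
  rewrite defM defN -zt -[LHS](cardJg _ (coset 'Z('GL_2[F]) u)).
  by rewrite conjIg conjGid ?mem_PGL2 // -normJ conjg_set1.
rewrite (card_isog isoM) (card_isog isoN) !mul2n !card_dihedral //.
by move/double_inj/eqP; rewrite ltn_eqF // addn1 ltnS leq_subr.
Qed.
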